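(* Let $p>10$ be a prime. For real $a<b$ write $\big(\frac{\prod}{p}\big)(a,b)=\prod_{x\in\mathbb Z,\ a<x<b}\big(\frac{x}{p}\big)$, let $\#N_p(6)$ be the number of quadratic non-residues modulo $p$ among the integers in $(p/12,p/6)\cup(p/4,p/3)\cup(5p/12,p/2)$, and $k\in\mathbb Z_{\ge0}$. (i) $(-1)^{\#N_p(6)}=\big(\frac{\prod}{p}\big)(p/4,p/3)$ if $p\equiv1\pmod4$, and $(-1)^{\#N_p(6)}=\big(\frac{3}{p}\big)\big(\frac{\prod}{p}\big)(p/4,p/3)$ if $p\equiv3\pmod 4$. (ii) $$(-1)^{\#N_p(6)}=\begin{cases}\big(\frac{\prod}{p}\big)(0,p/12) & p=1+24k,\\ (-1)^{k+1} & p=19+24k,\\ (-1)^{k+1} & p=23+24k,\\ (-1)^k\big(\frac{\prod}{p}\big)(0,p/2) & p=7+24k,\\ (-1)^{k+1}\big(\frac{\prod}{p}\big)(0,p/2) & p=11+24k.\end{cases}$$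
   Context: $\big(\frac{\cdot}{p}\big)$ is the Legendre symbol. *)

(* Defs.v *)
From mathcomp Require Import all_boot all_order all_algebra.
From mathcomp Require Import finmap.
From mathcomp Require Import mathcomp_extra boolp classical_sets functions.
From mathcomp Require Import cardinality fsbigop set_interval reals.
Set Implicit Arguments.
Unset Strict Implicit.
Unset Printing Implicit Defensive.
Import Order.TTheory GRing.Theory Num.Theory.
Local Open Scope classical_set_scope.
Local Open Scope ring_scope.

(* Intended for p prime, so that 'F_p is Z/pZ. Multiples of p count as squares
   here, so the integers failing this test are exactly the quadratic
   non-residues modulo p. *)
Definition is_square_mod (p : nat) (x : int) : bool :=
  [exists y : 'F_p, y ^+ 2 == x%:~R].

Definition legendre (x : int) (p : nat) : int :=
  if (p%:Z %| x)%Z then 0 else if is_square_mod p x then 1 else -1.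

(* The index set is bounded, hence finite, so this finitely supported product
   is the genuine one. *)
Definition legendre_prod (R : realType) (p : nat) (a b : R) : int :=
  \big[*%R/1]_(x \in [set x : int | a < x%:~R < b]) legendre x p.

(* fset_set sends an infinite set to fset0, but this set is bounded, hence
   finite. *)
Definition card_N6 (R : realType) (p : nat) : nat :=
  let P : R := p%:R in
  #|` fset_set [set x : int | ~~ is_square_mod p x /\
        (`]P / 12, P / 6[ `|` `]P / 4, P / 3[ `|` `]5 * P / 12, P / 2[)
          (x%:~R : R)] |.

(* Main.v *)
(* Write chi for the Legendre symbol and S_i for its sum over the i-th of the six
   intervals ((i-1)p/12, ip/12).  Sorting the integers of (0, m] by parity and
   writing them as 2z or p - 2z, or sorting them modulo 3 and writing them as 3z,
   p - 3z or 3z - p, expresses the partial sum of chi up to m through chi(-1),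
   chi(2), chi(3) and partial sums at other points.  For m = p/6, p/3, p/2 and 2,
   m = p/4, p/2 and 3, and m = p - 1 and 2 (where the full sum vanishes), all
   these points are multiples of p/12, so that one gets linear relations between
   the S_i.  The same foldings applied to factorials in F_p give chi(2) and
   chi(3) (Gauss's lemma).  As S_i is the number of integers in the interval minus
   twice the number N_i of non-residues, the relations determine, for each
   residue of p modulo 24, the parities of the sums of N_i that are compared. *)
Require Import Defs.
From mathcomp Require Import all_boot all_order all_algebra all_solvable all_field.
From mathcomp Require Import finmap classical_sets fsbigop cardinality.
From mathcomp Require Import set_interval reals zify lra.
Import Order.TTheory GRing.Theory Num.Theory.
Local Open Scope ring_scope.

(** * Quadratic character of a finite field of odd order *)

Definition quad_char {F : finFieldType} (x : F) : int :=
  if x == 0 then 0 else if [exists y : F, y ^+ 2 == x] then 1 else -1.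

Section QuadraticCharacter.
Context {F : finFieldType}.
Context (oddF : odd #|F|).

Local Notation chi := (@quad_char F).

Lemma quad_char0 : chi 0 = 0.
Proof. by rewrite /quad_char eqxx. Qed.

Lemma expf_card1 (x : F) : x != 0 -> x ^+ #|F|.-1 = 1.
Proof.
move=> x0; apply: (mulfI x0); rewrite -exprS prednK ?expf_card ?mulr1 //.
by rewrite (ltn_trans _ (finNzRing_gt1 F)).
Qed.

Lemma card_half : (#|F|./2 * 2 = #|F|.-1)%N.
Proof. by rewrite -{2}(odd_double_half #|F|) oddF /= muln2. Qed.

(** The #|F| - 1 nonzero elements are distinct roots of unity of order dividing #|F| - 1, and in a
    field so many of them include a primitive one. *)
Lemma exists_prim_root : exists z : F, #|F|.-1.-primitive_root z.
Proof.
have F1 : (1 < #|F|)%N := finNzRing_gt1 F.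
have: has #|F|.-1.-primitive_root (enum [pred x : F | x != 0]).
  apply: has_prim_root; rewrite ?enum_uniq //; first by lia.
  - apply/allP => x; rewrite mem_enum inE => x0.
    by rewrite unity_rootE expf_card1.
  - rewrite -cardE (cardD1 0 F) (eq_card (B := [pred x | x != 0])) //= => x.
    by rewrite !inE andbT.
by case/hasP => z _ zP; exists z.
Qed.

(** For a primitive root z, z ^ (#|F|./2) is a square root of 1. If 1 = -1, it would have to be 1,
    against the order of z. *)
Lemma oner_neqN1 : (1 : F) != -1.
Proof.
apply/eqP => e; have [z zP] := exists_prim_root.
have F1 : (1 < #|F|)%N := finNzRing_gt1 F.
have h2 := card_half.
have : (z ^+ (#|F|./2)) ^+ 2 = 1 by rewrite -exprM h2 (prim_expr_order zP).
move/eqP; rewrite sqrf_eq1 -e orbb -(prim_order_dvd zP).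
by move/dvdn_leq; lia.
Qed.

(** Euler's criterion. Writing x = z ^ i for a primitive root z and h = #|F|./2, x ^ h = 1 says that
    2h divides i * h, so that i is even. *)
Lemma square_half (x : F) : x != 0 ->
  [exists y : F, y ^+ 2 == x] = (x ^+ (#|F|./2) == 1).
Proof.
move=> x0; have h2 := card_half; have [z zP] := exists_prim_root.
have F1 : (1 < #|F|)%N := finNzRing_gt1 F.
apply/existsP/eqP => [[y /eqP yx]|xh].
  rewrite -yx -exprM mulnC h2 expf_card1 //.
  by apply: contraNneq x0 => y0; rewrite -yx y0 expr0n.
have [i xi] := prim_rootP zP (expf_card1 _ x0).
have : (#|F|.-1 %| i * #|F|./2)%N by rewrite (prim_order_dvd zP) exprM -xi xh.
case/dvdnP => j ij; exists (z ^+ j); rewrite -exprM xi.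
by apply/eqP; congr (_ ^+ _); nia.
Qed.

Lemma quad_char_euler (x : F) : (chi x)%:~R = x ^+ (#|F|./2).
Proof.
have h2 := card_half; have F1 : (1 < #|F|)%N := finNzRing_gt1 F.
rewrite /quad_char; have [->|x0] := eqVneq.
  by rewrite expr0n; case: eqP => //; lia.
rewrite square_half //; have [->//|ne] := eqVneq.
have /eqP : (x ^+ (#|F|./2)) ^+ 2 = 1 by rewrite -exprM h2 expf_card1.
by rewrite sqrf_eq1 (negPf ne) /= => /eqP ->; rewrite rmorphN1.
Qed.

Lemma quad_char_cases x : [\/ chi x = 0, chi x = 1 | chi x = -1].
Proof. by rewrite /quad_char; do 2?case: ifP => _; constructor. Qed.

(** The values 0, 1 and -1 stay distinct in F because 1 differs from -1 there. Integer identities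
    between characters can thus be checked in F, where Euler's criterion turns them into identities
    between powers. *)
Lemma sign_inj (a b : int) : [\/ a = 0, a = 1 | a = -1] ->
  [\/ b = 0, b = 1 | b = -1] -> a%:~R = b%:~R :> F -> a = b.
Proof.
have n1 := negPf oner_neqN1; have n0 := negPf (oner_neq0 F).
by case=> ->; case=> -> // /eqP;
  rewrite ?rmorphN1 ?rmorph0 ?rmorph1 1?eq_sym ?oppr_eq0 ?n0 ?n1
    // eq_sym ?oppr_eq0 ?n0 ?n1.
Qed.

Lemma quad_charM x y : chi (x * y) = chi x * chi y.
Proof.
apply: sign_inj; rewrite ?rmorphM /= ?quad_char_euler ?exprMn //.
  exact: quad_char_cases.
case: (quad_char_cases x) => ->; case: (quad_char_cases y) => ->;
  by [constructor 1|constructor 2|constructor 3].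
Qed.

Lemma quad_char_sign x n : x ^+ (#|F|./2) = (-1) ^+ n -> chi x = (-1) ^+ n.
Proof.
rewrite -quad_char_euler => e; apply: sign_inj; first exact: quad_char_cases.
  by rewrite -signr_odd; case: odd; [constructor 3|constructor 2].
by rewrite e rmorphXn /= rmorphN1.
Qed.

Lemma quad_charN1 : chi (-1) = (-1) ^+ (#|F|./2).
Proof. exact: quad_char_sign. Qed.

(** A primitive root z is not a square, and multiplication by z permutes F, so the sum equals its
    own opposite. *)
Lemma sum_quad_char : \sum_x chi x = 0.
Proof.
have h2 := card_half; have F1 : (1 < #|F|)%N := finNzRing_gt1 F.
have [z zP] := exists_prim_root.
have z0 : z != 0.
  apply/eqP => z0; have /eqP := prim_expr_order zP.
  rewrite z0 expr0n gtn_eqF; last by lia.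
  by rewrite eq_sym oner_eq0.
have zN : chi z = -1.
  rewrite /quad_char (negPf z0) square_half // -(prim_order_dvd zP).
  by case: ifP => // /dvdn_leq; lia.
have : \sum_x chi x = - \sum_x chi x.
  rewrite [LHS](reindex_inj (mulfI z0)) -sumrN; apply: eq_bigr => x _.
  by rewrite quad_charM zN mulN1r.
by move: (\sum_x _) => t; lia.
Qed.

End QuadraticCharacter.

(** * Sorting 1, ..., m by residue modulo 2 and modulo 3 *)

Section Folding.
Context {T : Type} {idx : T} {op : Monoid.com_law idx}.
Context (f : int -> T).

(** Induction on m: an even m + 1 is 2z with z a new top index of the first range, and an odd m + 1
    is p - 2z with z a new bottom index of the second. The operation is left abstract so as to serve
    for sums of characters and for factorials in 'F_p. *)
Lemma fold2 (p m : nat) : odd p -> (m < p)%N ->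
  \big[op/idx]_(1 <= x < m.+1) f x =
  op (\big[op/idx]_(1 <= z < (m./2).+1) f (2 * z%:Z))
     (\big[op/idx]_(((p - m.+1)./2).+1 <= z < (p./2).+1) f (p%:Z - 2 * z%:Z)).
Proof.
move=> p_odd; elim: m => [|m IH] mp.
  by rewrite !big_geq ?Monoid.mulm1 //; lia.
rewrite big_nat_recr //= IH; last by lia.
have [om|em] := boolP (odd m).
  have -> : (uphalf m = m./2.+1)%N by lia.
  have -> : ((p - m.+2)./2 = (p - m.+1)./2)%N by lia.
  rewrite [in RHS]big_nat_recr //= -[RHS]Monoid.mulmAC.
  by congr (op _ (f _)); lia.
have -> : (uphalf m = m./2)%N by lia.
have e : ((p - m.+1)./2 = (p - m.+2)./2.+1)%N by lia.
rewrite [X in _ = op _ X]big_ltn -?e; last by lia.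
rewrite -Monoid.mulmA; congr (op _ _).
rewrite [RHS]Monoid.mulmC; congr (op _ (f _)); lia.
Qed.

(** Same induction, where m + 1 is congruent to 0, p or -p modulo 3. These cases extend the first
    range at the top, the second at the bottom and the third at the top. *)
Lemma fold3 (p m : nat) : coprime p 3 -> (m < p)%N ->
  \big[op/idx]_(1 <= x < m.+1) f x =
  op (\big[op/idx]_(1 <= z < (m %/ 3).+1) f (3 * z%:Z))
  (op (\big[op/idx]_(((p - m.+1) %/ 3).+1 <= z < (p %/ 3).+1) f (p%:Z - 3 * z%:Z))
     (\big[op/idx]_((p %/ 3).+1 <= z < ((p + m) %/ 3).+1) f (3 * z%:Z - p%:Z))).
Proof.
move=> cp.
have {cp}p3 : (p %% 3 != 0)%N.
  by rewrite -/(dvdn _ _) -prime_coprime // coprime_sym.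
elim: m => [|m IH] mp.
  by rewrite !big_geq ?Monoid.mulm1 //; lia.
rewrite big_nat_recr //= IH; last by lia.
have [r0|r0] := eqVneq (m.+1 %% 3)%N 0%N.
  have -> : (m.+1 %/ 3 = (m %/ 3).+1)%N by lia.
  have -> : ((p - m.+2) %/ 3 = (p - m.+1) %/ 3)%N by lia.
  have -> : ((p + m.+1) %/ 3 = (p + m) %/ 3)%N by lia.
  rewrite [X in _ = op X _]big_nat_recr //= -[RHS]Monoid.mulmAC.
  by congr (op _ (f _)); lia.
have -> : (m.+1 %/ 3 = m %/ 3)%N by lia.
have [r1|r1] := eqVneq (m.+1 %% 3)%N (p %% 3)%N.
  have e : ((p - m.+1) %/ 3 = ((p - m.+2) %/ 3).+1)%N by lia.
  have -> : ((p + m.+1) %/ 3 = (p + m) %/ 3)%N by lia.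
  rewrite [X in _ = op _ (op X _)]big_ltn -?e; last by lia.
  rewrite -Monoid.mulmA -[in RHS]Monoid.mulmA; congr (op _ _).
  rewrite [RHS]Monoid.mulmC; congr (op _ (f _)); lia.
have -> : ((p - m.+2) %/ 3 = (p - m.+1) %/ 3)%N by lia.
have -> : ((p + m.+1) %/ 3 = ((p + m) %/ 3).+1)%N by lia.
rewrite [X in _ = op _ (op _ X)]big_nat_recr /=; last by lia.
rewrite !Monoid.mulmA; congr (op _ (f _)); lia.
Qed.

End Folding.

Lemma prod_nat_cat (A : comNzRingType) (G : nat -> A) (a b c : nat) :
  (a <= b <= c)%N ->
  \prod_(a.+1 <= x < b.+1) G x * \prod_(b.+1 <= x < c.+1) G x =
  \prod_(a.+1 <= x < c.+1) G x.
Proof. by move=> abc; rewrite -big_cat_nat //; lia. Qed.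

Lemma scale_prod (A : comNzRingType) (u : A) (a b : nat) :
  \prod_(a.+1 <= x < b.+1) (u * x%:R) =
  u ^+ (b - a) * \prod_(a.+1 <= x < b.+1) (x%:R : A).
Proof. by rewrite big_split /= prodr_const_nat subSS. Qed.

(** * Legendre symbols, their partial sums and counts of non-residues *)

Definition nonresidues (p m : nat) : nat :=
  count (fun x : nat => ~~ is_square_mod p x%:Z) (index_iota 1 m.+1).

Definition legendre_sum (p m : nat) : int := \sum_(1 <= x < m.+1) legendre x%:Z p.

Section LegendreSymbol.
Context {p : nat} (pP : prime p).

Lemma intr_Fp_eq0 (x : int) : (x%:~R == 0 :> 'F_p) = (p%:Z %| x)%Z.
Proof. by rewrite (dvdz_pcharf (pchar_Fp pP)). Qed.

Lemma legendreE x : legendre x p = quad_char (x%:~R : 'F_p).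
Proof. by rewrite /legendre /quad_char intr_Fp_eq0. Qed.

Lemma nonresiduesS m :
  nonresidues p m.+1 = (nonresidues p m + ~~ is_square_mod p m.+1%:Z)%N.
Proof.
rewrite /nonresidues /index_iota !subSS !subn0 -[X in iota _ X]addn1.
by rewrite iotaD count_cat /= addn0 add1n.
Qed.

Lemma legendre_nz m : (0 < m < p)%N ->
  legendre m%:Z p = (-1) ^+ (~~ is_square_mod p m%:Z).
Proof.
move=> mp; rewrite /legendre ifF; first by case: is_square_mod.
by rewrite dvdzE /=; apply/negP => /dvdn_leq; lia.
Qed.

Lemma legendre_sumE m : (m < p)%N ->
  legendre_sum p m = m%:Z - 2 * (nonresidues p m)%:Z.
Proof.
rewrite /legendre_sum; elim: m => [|m IH] mp; first by rewrite big_geq.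
rewrite big_nat_recr //= IH ?nonresiduesS ?legendre_nz //=; last by lia.
by case: is_square_mod => /=; lia.
Qed.

(** The exponent is a sum where a difference would be expected. The parity is the same, and
    truncated subtraction is avoided. *)
Lemma legendre_prodE a b : (a <= b < p)%N ->
  \prod_(a.+1 <= x < b.+1) legendre x%:Z p =
    (-1) ^+ (nonresidues p a + nonresidues p b).
Proof.
elim: b => [|b IH] ab; first by rewrite big_geq // (_ : a = 0%N) //; lia.
have [->|ne] := eqVneq a b.+1.
  by rewrite big_geq // addnn -mul2n exprM sqrrN !expr1n.
rewrite big_nat_recr /= ?IH ?nonresiduesS ?legendre_nz ?addnA -?exprD //; lia.
Qed.

Context (p_odd : odd p).

Lemma odd_card_Fp : odd #|'F_p|.
Proof. by rewrite card_Fp. Qed.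

Lemma legendreM x y : legendre (x * y) p = legendre x p * legendre y p.
Proof. by rewrite !legendreE rmorphM quad_charM // odd_card_Fp. Qed.

Lemma legendreBp x : legendre (p%:Z - x) p = legendre (-1) p * legendre x p.
Proof.
rewrite -legendreM mulN1r !legendreE rmorphB rmorphN /=.
by rewrite [p%:~R](pcharf0 (pchar_Fp pP)) sub0r.
Qed.

Lemma legendreBpr x : legendre (x - p%:Z) p = legendre x p.
Proof.
by rewrite !legendreE rmorphB /= [p%:~R](pcharf0 (pchar_Fp pP)) subr0.
Qed.

Lemma legendreN1 : legendre (-1) p = (-1) ^+ p./2.
Proof. by rewrite legendreE quad_charN1 ?odd_card_Fp // card_Fp. Qed.

Lemma legendre_sign x n : (x%:~R : 'F_p) ^+ p./2 = (-1) ^+ n ->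
  legendre x p = (-1) ^+ n.
Proof.
move=> e; rewrite legendreE; apply: quad_char_sign; first exact: odd_card_Fp.
by rewrite card_Fp.
Qed.

Lemma prod_half_neq0 : \prod_(1 <= x < (p./2).+1) (x%:R : 'F_p) != 0.
Proof.
rewrite prodf_seq_neq0; apply/allP => x; rewrite mem_index_iota => xp.
rewrite -(dvdn_pcharf (pchar_Fp pP)); apply/negP => /dvdn_leq; lia.
Qed.

(** Gauss's lemma: with h = p./2, folding h! in 'F_p gives h! = s * 2 ^ h * h!, where s collects the
    signs of the factors p - 2z = -2z. *)
Lemma legendre2 : legendre 2 p = (-1) ^+ (p./2 - p./2./2).
Proof.
apply: legendre_sign.
(* Hence the second range starts right after the first one ends, and together they run over 1, ...,
   h. *)
have hp : (p - p./2.+1 = p./2)%N by lia.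
have := @fold2 _ _ [the Monoid.com_law _ of *%R] (fun x => x%:~R : 'F_p) p p./2 p_odd _.
rewrite hp /= => /(_ ltac:(lia)).
under [X in _ = X * _ -> _]eq_bigr => z _ do rewrite rmorphM /=.
under [X in _ = _ * X -> _]eq_bigr => z _ do
  rewrite rmorphB /= [p%:~R](pcharf0 (pchar_Fp pP)) sub0r rmorphM -mulNr /=.
rewrite !scale_prod mulrACA prod_nat_cat; last by lia.
rewrite subn0 -[LHS]mul1r => /(mulIf prod_half_neq0).
rewrite [(- 2%:~R) ^+ _]exprNn mulrCA -exprD subnKC; last by lia.
(* From 1 = s * 2 ^ h follows 2 ^ h = s, since s squares to 1. *)
set s := (-1) ^+ _ => e; rewrite -[RHS]mulr1 [X in s * X]e mulrA.
by rewrite -exprD -signr_odd oddD addbb mul1r.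
Qed.

(** As for 2: the three ranges are consecutive and fill 1, ..., p./2, and only the middle one, with
    factors p - 3z = -3z, contributes signs. *)
Lemma legendre3 : (3 < p)%N -> legendre 3 p = (-1) ^+ (p %/ 3 - p./2 %/ 3).
Proof.
move=> p3; apply: legendre_sign.
have cp : coprime p 3 by rewrite coprime_sym prime_coprime // dvdn_prime2 //; lia.
have hp : (p - p./2.+1 = p./2)%N by lia.
have hq : ((p + p./2) %/ 3 = p./2)%N by lia.
have := @fold3 _ _ [the Monoid.com_law _ of *%R] (fun x => x%:~R : 'F_p) p p./2 cp _.
rewrite hp hq /= => /(_ ltac:(lia)).
under [X in _ = X * _ -> _]eq_bigr => z _ do rewrite rmorphM /=.
under [X in _ = _ * (X * _) -> _]eq_bigr => z _ do
  rewrite rmorphB /= [p%:~R](pcharf0 (pchar_Fp pP)) sub0r rmorphM -mulNr /=.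
under [X in _ = _ * (_ * X) -> _]eq_bigr => z _ do
  rewrite rmorphB /= [p%:~R](pcharf0 (pchar_Fp pP)) subr0 rmorphM /=.
rewrite !scale_prod [X in _ * X]mulrACA prod_nat_cat; last by lia.
rewrite mulrACA prod_nat_cat; last by lia.
rewrite subn0 -[LHS]mul1r => /(mulIf prod_half_neq0).
rewrite [(- 3%:~R) ^+ _]exprNn -mulrA mulrCA -!exprD.
have -> : (p./2 %/ 3 + (p %/ 3 - p./2 %/ 3 + (p./2 - p %/ 3)) = p./2)%N by lia.
set s := (-1) ^+ _ => e; rewrite -[RHS]mulr1 [X in s * X]e mulrA.
by rewrite -exprD -signr_odd oddD addbb mul1r.
Qed.

Lemma legendre_sum0 : legendre_sum p 0 = 0.
Proof. by rewrite /legendre_sum big_geq. Qed.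

Lemma sum_nat_diff a b : (a <= b)%N ->
  \sum_(a.+1 <= x < b.+1) legendre x%:Z p = legendre_sum p b - legendre_sum p a.
Proof.
move=> ab; rewrite /legendre_sum (@big_cat_nat _ _ _ a.+1 1 b.+1) //=.
by rewrite [RHS]addrC addKr.
Qed.

Lemma legendre_sum_fold2 m : (m < p)%N -> legendre_sum p m =
  legendre 2 p * (legendre_sum p m./2 +
    legendre (-1) p * (legendre_sum p p./2 - legendre_sum p (p - m.+1)./2)).
Proof.
move=> mp; rewrite {1}/legendre_sum.
rewrite (@fold2 _ _ [the Monoid.com_law _ of +%R] (fun x => legendre x p) p m) //=.
under eq_bigr => z _ do rewrite legendreM.
under [X in _ + X]eq_bigr => z _ do rewrite legendreBp legendreM.
by rewrite -!mulr_sumr !sum_nat_diff ?legendre_sum0; lia.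
Qed.

Lemma legendre_sum_fold3 m : (3 < p)%N -> (m < p)%N -> legendre_sum p m =
  legendre 3 p * (legendre_sum p (m %/ 3) +
    legendre (-1) p * (legendre_sum p (p %/ 3) - legendre_sum p ((p - m.+1) %/ 3)) +
    (legendre_sum p ((p + m) %/ 3) - legendre_sum p (p %/ 3))).
Proof.
move=> p3 mp; rewrite {1}/legendre_sum.
have cp : coprime p 3 by rewrite coprime_sym prime_coprime // dvdn_prime2 //; lia.
rewrite (@fold3 _ _ [the Monoid.com_law _ of +%R] (fun x => legendre x p) p m) //=.
under eq_bigr => z _ do rewrite legendreM.
under [X in _ + (X + _)]eq_bigr => z _ do rewrite legendreBp legendreM.
under [X in _ + (_ + X)]eq_bigr => z _ do rewrite legendreBpr legendreM.
by rewrite -!mulr_sumr !sum_nat_diff ?legendre_sum0; lia.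
Qed.

Lemma legendre_sum_full : legendre_sum p p.-1 = 0.
Proof.
have p0 := prime_gt0 pP.
have : \sum_(0 <= i < p) quad_char (i%:R : 'F_p) = 0.
  rewrite -[X in index_iota _ X](Fp_cast pP) big_mkord.
  rewrite -[RHS](sum_quad_char odd_card_Fp).
  by apply: eq_bigr => x _; rewrite natr_Zp.
rewrite big_ltn // quad_char0 add0r => e.
rewrite /legendre_sum prednK // -[RHS]e.
by apply: eq_bigr => x _; rewrite legendreE.
Qed.

End LegendreSymbol.

(** * Intervals with endpoints at multiples of p/12 *)

Section Twelfths.
Context {R : realType}.
Context {p : nat} (pP : prime p) (p_gt3 : (3 < p)%N).

Definition twelfths (c d : nat) : seq nat :=
  index_iota (c * p %/ 12).+1 (d * p %/ 12).+1.

(** The half-open integer range agrees with the open real interval because dp/12 is not an integer: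
    12 is coprime to p and 0 < d < 12. The endpoints are given through a * 12 and b * 12 so that
    fractions of any shape, such as P / 4 or 5 * P / 12, fit. *)
Lemma mem_twelfths (c d : nat) (a b : R) (x : int) :
  a * 12 = (c * p)%:R -> b * 12 = (d * p)%:R -> (0 < d < 12)%N ->
  (a < x%:~R < b) = (x \in [seq n%:Z | n <- twelfths c d]).
Proof.
move=> ac bd d12.
have -> : (a < x%:~R < b) = ((c * p)%:Z < x * 12 < (d * p)%:Z).
  have x12 : x%:~R * 12 = (x * 12)%:~R :> R by rewrite intrM.
  have t12 : 0 < 12 :> R by [].
  by rewrite -(ltr_pM2r t12 a) -(ltr_pM2r t12 _ b) ac bd x12 !pmulrn !ltr_int.
have cop : ~~ (12 %| d * p)%N.
  have cp : coprime 12 p.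
    rewrite (_ : 12 = 2 ^ 2 * 3)%N // coprimeMl coprimeXl ?prime_coprime //
      ?dvdn_prime2 //; lia.
  by rewrite Gauss_dvdl //; apply/negP => /dvdn_leq; lia.
apply/idP/mapP => [xcd|[n ncd ->]].
  exists `|x|%N; last by lia.
  by rewrite mem_index_iota; lia.
by move: ncd; rewrite mem_index_iota; lia.
Qed.

Lemma legendre_prod_twelfths (c d : nat) (a b : R) :
  a * 12 = (c * p)%:R -> b * 12 = (d * p)%:R -> (c <= d)%N -> (0 < d < 12)%N ->
  legendre_prod p a b =
    (-1) ^+ (nonresidues p (c * p %/ 12) + nonresidues p (d * p %/ 12)).
Proof.
move=> ac bd cd d12; rewrite /legendre_prod.
have -> : [set x : int | a < x%:~R < b]%classic =
          [set` [seq n%:Z | n <- twelfths c d]]%classic.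
  by apply/seteqP; split=> x /=; rewrite (mem_twelfths _ _ _ _ _ ac bd d12).
rewrite -fsbig_seq; last by rewrite map_inj_uniq ?iota_uniq // => m n [].
rewrite big_map legendre_prodE //; nia.
Qed.

Lemma count_twelfths (c d : nat) : (c <= d)%N ->
  count (fun n => ~~ is_square_mod p n%:Z) (twelfths c d) =
  (nonresidues p (d * p %/ 12) - nonresidues p (c * p %/ 12))%N.
Proof.
move=> cd; rewrite /nonresidues /twelfths /index_iota !subSS !subn0.
have -> : (d * p %/ 12 = c * p %/ 12 + (d * p %/ 12 - c * p %/ 12))%N by nia.
by rewrite iotaD count_cat !addKn.
Qed.

Lemma nonresidues_mono m n : (m <= n)%N -> (nonresidues p m <= nonresidues p n)%N.
Proof.
move=> mn; rewrite -(subnKC mn) /nonresidues /index_iota !subSS !subn0.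
by rewrite iotaD count_cat leq_addr.
Qed.

Lemma card_N6_twelfths : card_N6 R p =
  (nonresidues p (2 * p %/ 12) - nonresidues p (1 * p %/ 12) +
   (nonresidues p (4 * p %/ 12) - nonresidues p (3 * p %/ 12)) +
   (nonresidues p (6 * p %/ 12) - nonresidues p (5 * p %/ 12)))%N.
Proof.
rewrite -!count_twelfths // -!count_cat -size_filter.
set s := filter _ _; rewrite -(size_map Posz) /card_N6.
set P : R := p%:R.
have -> : [set x : int | ~~ is_square_mod p x /\
     (`]P / 12, P / 6[ `|` `]P / 4, P / 3[ `|` `]5 * P / 12, P / 2[)%classic
          (x%:~R : R)]%classic = [set` [seq n%:Z | n <- s]]%classic.
  apply/seteqP; rewrite !set_itvE; split=> x /=;
    rewrite (@mem_twelfths 1 2 (P / 12) (P / 6)) ?(@mem_twelfths 3 4 (P / 4) (P / 3))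
      ?(@mem_twelfths 5 6 (5 * P / 12) (P / 2)) ?natrM -/P //; try lra.
  - move=> [xN xs].
    have xm : x \in [seq n%:Z | n <- (twelfths 1 2 ++ twelfths 3 4) ++
                                      twelfths 5 6].
      by rewrite !map_cat !mem_cat; case: xs => [[]|] ->; rewrite ?orbT.
    by case/mapP: xm xN => n ns -> nN; rewrite map_f // mem_filter nN.
  - move=> /mapP[n]; rewrite mem_filter => /andP[nN ns] ->; split => //.
    by move: ns; rewrite !mem_cat => /orP[/orP[]|] nI;
      [left; left|left; right|right]; rewrite map_f.
apply/perm_size/uniq_perm; rewrite ?fset_uniq //.
  rewrite map_inj_uniq; last by move=> m n [].
  apply/filter_uniq; rewrite !cat_uniq !iota_uniq /= !andbT.
  apply/andP; split; apply/hasPn => n; rewrite ?mem_cat !mem_index_iota; nia.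
by move=> x; rewrite in_fset_set ?mem_setE //; exact: finite_seq.
Qed.

End Twelfths.

(** * Linear relations between the partial sums up to ip/12 *)

Lemma legendre_sum_relations (p : nat) : prime p -> (3 < p)%N ->
  let S (i : nat) := legendre_sum p (i * p %/ 12) in
  let l1 := legendre (-1) p in
  let l2 := legendre 2 p in
  let l3 := legendre 3 p in
  [/\ S 2%N = l2 * (S 1%N + l1 * (S 6%N - S 5%N)),
      S 4%N = l2 * (S 2%N + l1 * (S 6%N - S 4%N)),
      S 6%N = l2 * (S 3%N + l1 * (S 6%N - S 3%N)) &
   [/\ S 3%N = l3 * (S 1%N + l1 * (S 4%N - S 3%N) + (S 5%N - S 4%N)),
      S 6%N = l3 * (S 2%N + l1 * (S 4%N - S 2%N) + (S 6%N - S 4%N)) &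
      0 = l2 * (S 6%N + l1 * S 6%N)]].
Proof.
move=> pP p3 S l1 l2 l3.
have p2 : (p %% 2 != 0)%N by rewrite -/(dvdn _ _) dvdn_prime2 //; lia.
have p3n : (p %% 3 != 0)%N by rewrite -/(dvdn _ _) dvdn_prime2 //; lia.
have po : odd p by lia.
have f2 m a b : (m < p)%N -> (m./2 = a)%N -> ((p - m.+1)./2 = b)%N ->
    legendre_sum p m = l2 * (legendre_sum p a + l1 * (S 6%N - legendre_sum p b)).
  move=> mp <- <-; rewrite /S (_ : 6 * p %/ 12 = p./2)%N; last by lia.
  exact: (legendre_sum_fold2 pP po).
have f3 m a b c : (m < p)%N -> (m %/ 3 = a)%N -> ((p - m.+1) %/ 3 = b)%N ->
    ((p + m) %/ 3 = c)%N -> legendre_sum p m =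
    l3 * (legendre_sum p a + l1 * (S 4%N - legendre_sum p b) +
      (legendre_sum p c - S 4%N)).
  move=> mp <- <- <-; rewrite /S (_ : 4 * p %/ 12 = p %/ 3)%N; last by lia.
  exact: (legendre_sum_fold3 pP po).
(* If cp/12 is not an integer and m is its floor, then p - m - 1 is the floor of (12 - c)p/12, so
   every index is again the floor of a multiple of p/12. *)
split; [apply: f2; lia.. |split; [apply: f3; lia..|]].
(* Folding the vanishing full sum gives the last relation, which forces the sum up to p/2 to vanish
   when -1 is a square. *)
have := f2 p.-1 p./2 0%N ltac:(lia) ltac:(lia) ltac:(lia).
rewrite legendre_sum_full // legendre_sum0 subr0 => ->.
by rewrite /S (_ : 6 * p %/ 12 = p./2)%N; last by lia.
Qed.

(** * Comparison of parities for each residue of p modulo 24 *)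

Lemma sign_eq_odd (a b : nat) : odd a = odd b -> (-1) ^+ a = (-1) ^+ b :> int.
Proof. by move=> ab; rewrite -signr_odd ab signr_odd. Qed.

Theorem theorem4p12 (R : realType) (p k : nat)
    (hp : prime p) (hp10 : (10 < p)%N) :
  let P : R := p%:R in
  let s : int := (-1) ^+ card_N6 R p in
  (((p = 1 %[mod 4])%N -> s = legendre_prod p (P / 4) (P / 3)) /\
   ((p = 3 %[mod 4])%N ->
      s = legendre 3 p * legendre_prod p (P / 4) (P / 3))) /\
  ((p = (1 + 24 * k)%N -> s = legendre_prod p 0 (P / 12)) /\
   (p = (19 + 24 * k)%N -> s = (-1) ^+ k.+1) /\
   (p = (23 + 24 * k)%N -> s = (-1) ^+ k.+1) /\
   (p = (7 + 24 * k)%N -> s = (-1) ^+ k * legendre_prod p 0 (P / 2)) /\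
   (p = (11 + 24 * k)%N -> s = (-1) ^+ k.+1 * legendre_prod p 0 (P / 2))).
Proof.
move=> P s.
have p3 : (3 < p)%N by lia.
have p2 : (p %% 2 != 0)%N by rewrite -/(dvdn _ _) dvdn_prime2 //; lia.
have p3n : (p %% 3 != 0)%N by rewrite -/(dvdn _ _) dvdn_prime2 //; lia.
have po : odd p by lia.
have s43 : legendre_prod p (P / 4) (P / 3) =
    (-1) ^+ (nonresidues p (3 * p %/ 12) + nonresidues p (4 * p %/ 12)).
  by apply: legendre_prod_twelfths; rewrite ?natrM -/P //; lra.
have s01 : legendre_prod p 0 (P / 12) = (-1) ^+ nonresidues p (1 * p %/ 12).
  by rewrite (legendre_prod_twelfths hp p3 0 1) ?natrM -/P //; lra.
have s06 : legendre_prod p 0 (P / 2) = (-1) ^+ nonresidues p (6 * p %/ 12).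
  by rewrite (legendre_prod_twelfths hp p3 0 6) ?natrM -/P //; lra.
have := legendre3 hp po p3; have := legendre2 hp po; have := legendreN1 hp po.
have := legendre_sum_relations p hp p3.
(* These inequalities make the truncated differences in [card_N6_twelfths] true differences. *)
have n12 : (nonresidues p (1 * p %/ 12) <= nonresidues p (2 * p %/ 12))%N.
  by apply: nonresidues_mono; lia.
have n34 : (nonresidues p (3 * p %/ 12) <= nonresidues p (4 * p %/ 12))%N.
  by apply: nonresidues_mono; lia.
have n56 : (nonresidues p (5 * p %/ 12) <= nonresidues p (6 * p %/ 12))%N.
  by apply: nonresidues_mono; lia.
rewrite s43 s01 s06 /s card_N6_twelfths // /=.
rewrite !legendre_sumE; try lia.
move: n12 n34 n56.
set N1 := nonresidues p (1 * _ %/ _); set N2 := nonresidues p (2 * _ %/ _).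
set N3 := nonresidues p (3 * _ %/ _); set N4 := nonresidues p (4 * _ %/ _).
set N5 := nonresidues p (5 * _ %/ _); set N6 := nonresidues p (6 * _ %/ _).
move=> n12 n34 n56 [r1 r2 r3 [r4 r5 r6]] e1 e2 e3.
set q := (p %/ 24)%N; set r := (p %% 24)%N.
have pq : p = (24 * q + r)%N by rewrite mulnC -divn_eq.
have rE : r \in [:: 1; 5; 7; 11; 13; 17; 19; 23]%N by rewrite !inE; lia.
(* The characters of -1, 2 and 3 depend only on p modulo 4, 8 and 12, hence on r. *)
have [o1 o2 o3] : [/\ odd p./2 = (r %% 4 == 3),
    odd (p./2 - p./2./2) = (r %% 8 \in [:: 3; 5]) &
    odd (p %/ 3 - p./2 %/ 3) = (r %% 12 \in [:: 5; 7])]%N.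
  by move: rE; rewrite pq !inE => rE; split; lia.
rewrite -[RHS]signr_odd o1 in e1; rewrite -[RHS]signr_odd o2 in e2.
rewrite -[RHS]signr_odd o3 in e3.
(* For a fixed residue r the floors become affine in q, so the relations are linear in q and the
   N_i. *)
have p12 i : (i * p %/ 12 = 2 * i * q + i * r %/ 12)%N.
  by rewrite pq mulnDr (_ : i * (24 * q) = 2 * i * q * 12)%N ?divnMDl //; lia.
rewrite e3 -!exprD; rewrite e1 e2 e3 !p12 in r1 r2 r3 r4 r5 r6.
clearbody N1 N2 N3 N4 N5 N6 q r; clear - n12 n34 n56 pq r1 r2 r3 r4 r5 r6 rE.
move: rE pq r1 r2 r3 r4 r5 r6; rewrite !inE.
repeat case/orP; move=> /eqP -> pq; rewrite /= ?(expr0, expr1) => r1 r2 r3 r4 r5 r6.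
(* Each residue is first tested against the congruence assumed in each claim. For the compatible
   ones, the parity of the exponents follows from the linear relations over the integers. *)
all: (do !split) => pE; apply: sign_eq_odd;
  try by (exfalso; clear - pq pE; lia).
all: lia.
Qed.
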